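(* Let $X$ be a compact convex set in $\mathbb{R}^n$ with diameter $D$ and let $\theta$ be locally Lipschitz continuous on $X$. Suppose that condition (LEB) with the constant pair $(\varepsilon,\eta)$, and conditions (SR1) (with constant $\kappa$) and (SR2), all stated in the context, hold for the problem $\min_{x\in X}\theta(x)$ and the convex surrogate functions $\widehat V(\bullet;x')$, $x'\in X$. Then for every $\rho>0$, with $$\widehat\eta\triangleq\max\left\{2+\eta\left(\frac2\rho+\frac{5\kappa}{2}\right),\ \frac{2D}{\varepsilon}\left(\frac2\rho+\frac{5\kappa}{2}\right)\right\},$$ it holds that $$\mathrm{dist}\big(x;S^C_{X,\theta}\big)\le\widehat\eta\; r_{\widetilde V_\rho}(x)\qquad\text{for all }x\in X.$$
   Context: The norm is Euclidean. $\theta$ is real-valued and locally Lipschitz continuous so that its Clarke subdifferential $\partial_C\theta(x)$ is well defined at every $x\in X$; $\mathcal N(x;X)$ is the normal cone of $X$ at $x$. The set of C(larke)-stationary points is $S^C_{X,\theta}=\{x\in X: 0\in\partial_C\theta(x)+\mathcal N(x;X)\}$, and $r^C_{X,\theta}(x)=\mathrm{dist}(0;\partial_C\theta(x)+\mathcal N(x;X))$. (LEB) with constants $\varepsilon,\eta>0$: for all $x\in X$, $r^C_{X,\theta}(x)\le\varepsilon$ implies $\mathrm{dist}(x;S^C_{X,\theta})\le\eta\, r^C_{X,\theta}(x)$. (SR1) For every $x'\in X$ there is a convex function $\widehat V(\bullet;x')$ on $X$ with (i) $\widehat V(x';x')=\theta(x')$; (ii) $\widehat V(x;x')\ge\theta(x)$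 for all $x\in X$; (iii) for some constant $\kappa>0$ independent of $x'$, $\theta(x)+\frac\kappa2\|x-x'\|^2\ge\widehat V(x;x')$ for all $x\in X$. (SR2) $\{x\in X: x\in\operatorname{argmin}_{y\in X}\widehat V(y;x)\}\subseteq S^C_{X,\theta}$. For $\rho>0$: $\widetilde V_\rho(x;x')=\widehat V(x;x')+\frac1{2\rho}\|x-x'\|^2$, $\mathcal M_{\widetilde V_\rho}(x')$ is the unique minimizer of $\widetilde V_\rho(\bullet;x')$ over $X$, and $r_{\widetilde V_\rho}(x)=\|x-\mathcal M_{\widetilde V_\rho}(x)\|$. (Condition (SR2) is equivalent to requiring that the fixed points in $X$ of $\mathcal M_{\widetilde V_\rho}$ belong to $S^C_{X,\theta}$ for any $\rho>0$.) *)

(* Defs.v *)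
From HB Require Import structures.
From mathcomp Require Import all_boot all_order all_algebra.
From mathcomp Require Import all_classical all_reals all_analysis.
Set Implicit Arguments.
Unset Strict Implicit.
Unset Printing Implicit Defensive.
Import Order.TTheory GRing.Theory Num.Theory.
Import numFieldNormedType.Exports.
Local Open Scope classical_set_scope.
Local Open Scope ring_scope.

(* The library norm on 'rV[R]_n is the max norm.  It only provides the topology
   (which is the usual one); all metric quantities use enorm below. *)
Definition dot (R : realType) (n : nat) (u v : 'rV[R]_n) : R :=
  \sum_(i < n) u 0 i * v 0 i.

Definition enorm (R : realType) (n : nat) (u : 'rV[R]_n) : R :=
  Num.sqrt (dot u u).

(* Extended-real valued, with value +oo when A is empty. *)
Definition dist (R : realType) (n : nat) (x : 'rV[R]_n) (A : set 'rV[R]_n) :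
    \bar R :=
  ereal_inf [set (enorm (x - a))%:E | a in A].

Definition diameter (R : realType) (n : nat) (X : set 'rV[R]_n) : R :=
  sup [set enorm (p.1 - p.2) | p in X `*` X].

(* The neighborhoods U are taken in R^n, not relative to X, so that f is
   Lipschitz around every point of X, as the Clarke derivative requires. *)
Definition locally_lipschitz (R : realType) (n : nat) (X : set 'rV[R]_n)
    (f : 'rV[R]_n -> R) : Prop :=
  forall x, X x -> exists (U : set 'rV[R]_n) (L : R), nbhs x U /\
    forall y z, U y -> U z -> `|f y - f z| <= L * enorm (y - z).

(* limsup of (f (y + t d) - f y) / t as y --> x and t --> 0, t > 0. *)
Definition clarke_derivative (R : realType) (n : nat) (f : 'rV[R]_n -> R)
    (x d : 'rV[R]_n) : \bar R :=
  limf_esup (fun p : 'rV[R]_n * R => ((f (p.1 + p.2 *: d) - f p.1) / p.2)%:E)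
            (filter_prod (nbhs x) (0 : R)^'+).

Definition clarke_subdifferential (R : realType) (n : nat)
    (f : 'rV[R]_n -> R) (x : 'rV[R]_n) : set 'rV[R]_n :=
  [set v | forall d : 'rV[R]_n, ((dot v d)%:E <= clarke_derivative f x d)%E].

(* Normal cone of convex analysis; meaningful for x in X. *)
Definition normal_cone (R : realType) (n : nat) (X : set 'rV[R]_n)
    (x : 'rV[R]_n) : set 'rV[R]_n :=
  [set w | forall y, X y -> dot w (y - x) <= 0].

Definition stationarity_set (R : realType) (n : nat) (X : set 'rV[R]_n)
    (theta : 'rV[R]_n -> R) (x : 'rV[R]_n) : set 'rV[R]_n :=
  [set v + w | v in clarke_subdifferential theta x & w in normal_cone X x].

Definition C_stationary (R : realType) (n : nat) (X : set 'rV[R]_n)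
    (theta : 'rV[R]_n -> R) : set 'rV[R]_n :=
  [set x | X x /\ stationarity_set X theta x 0].

Definition C_residual (R : realType) (n : nat) (X : set 'rV[R]_n)
    (theta : 'rV[R]_n -> R) (x : 'rV[R]_n) : \bar R :=
  dist 0 (stationarity_set X theta x).

Definition LEB (R : realType) (n : nat) (X : set 'rV[R]_n)
    (theta : 'rV[R]_n -> R) (eps eta : R) : Prop :=
  forall x, X x -> (C_residual X theta x <= eps%:E)%E ->
    (dist x (C_stationary X theta) <= eta%:E * C_residual X theta x)%E.

Definition argmin (R : realType) (n : nat) (X : set 'rV[R]_n)
    (f : 'rV[R]_n -> R) : set 'rV[R]_n :=
  [set y | X y /\ forall z, X z -> f y <= f z].

(* Surrogates are written V x x' for the value at x of the surrogate based at
   x'; only the values for x and x' in X are ever constrained or used. *)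
Definition SR1 (R : realType) (n : nat) (X : set 'rV[R]_n)
    (theta : 'rV[R]_n -> R) (V : 'rV[R]_n -> 'rV[R]_n -> R) (kappa : R) :
    Prop :=
  forall x', X x' ->
  [/\ convex_function X (V ^~ x'),
      V x' x' = theta x',
      forall x, X x -> theta x <= V x x' &
      forall x, X x -> V x x' <= theta x + kappa / 2 * enorm (x - x') ^+ 2].

Definition SR2 (R : realType) (n : nat) (X : set 'rV[R]_n)
    (theta : 'rV[R]_n -> R) (V : 'rV[R]_n -> 'rV[R]_n -> R) : Prop :=
  [set x | X x /\ argmin X (V ^~ x) x] `<=` C_stationary X theta.

Definition reg_surrogate (R : realType) (n : nat)
    (V : 'rV[R]_n -> 'rV[R]_n -> R) (rho : R) (x x' : 'rV[R]_n) : R :=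
  V x x' + 1 / (2 * rho) * enorm (x - x') ^+ 2.

(* The minimizer over X of the regularized surrogate based at x'.  Strict
   convexity makes it unique.  When no minimizer exists (possible, since
   a convex function on X may fail to be lower semicontinuous at the boundary)
   the value is a default without meaning. *)
Definition surrogate_map (R : realType) (n : nat) (X : set 'rV[R]_n)
    (V : 'rV[R]_n -> 'rV[R]_n -> R) (rho : R) (x' : 'rV[R]_n) : 'rV[R]_n :=
  get (argmin X (reg_surrogate V rho ^~ x')).

Definition surrogate_residual (R : realType) (n : nat) (X : set 'rV[R]_n)
    (V : 'rV[R]_n -> 'rV[R]_n -> R) (rho : R) (x : 'rV[R]_n) : R :=
  enorm (x - surrogate_map X V rho x).

(* Main.v *)
(* Let z be the minimizer of the regularized surrogate based at x, r = |x - z|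
   and g = (z - x) / rho.  Linearizing the proximal term at z and using (SR1)
   gives, for y in X,
     theta z <= theta y + <g, y - z> + kappa / 2 * |y - x|^2.
   Hence a minimizer xb over X of
     theta y + <g, y> + kappa * (q / 2 + 2 r^2 q / (r^2 + q)),  q = |y - x|^2,
   satisfies |xb - x| <= 2 r, and the gradient at xb of the part added to theta
   has norm at most (1 / rho + 5 kappa / 2) r.  This bounded smooth penalty
   replaces Ekeland's variational principle.  It is concave in q, so theta plus
   a linear and a quadratic term is minimized at xb, and a finite-dimensional
   Hahn-Banach argument, applied to the Clarke derivative and the cone
   generated by X - xb, turns this into an element of the stationarity set.
   (LEB) applies at xb when the residual bound is at most eps; otherwise the
   diameter of X is a sufficient bound. *)

Require Import Defs.
From HB Require Import structures.
From mathcomp Require Import all_boot all_order all_algebra.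
From mathcomp Require Import all_classical all_reals all_analysis.
From mathcomp Require Import ring lra.
Import Order.TTheory GRing.Theory Num.Theory.
Import numFieldNormedType.Exports.
Local Open Scope classical_set_scope.
Local Open Scope ring_scope.

(** * Euclidean inner product, norm and diameter *)

Section EuclideanSpace.
Context {R : realType} {n : nat}.
Implicit Types u v w : 'rV[R]_n.

Lemma dotC u v : dot u v = dot v u.
Proof. by apply: eq_bigr => i _; rewrite mulrC. Qed.

Lemma dotDl u v w : dot (u + v) w = dot u w + dot v w.
Proof. by rewrite /dot -big_split; apply: eq_bigr => i _; rewrite !mxE mulrDl. Qed.

Lemma dotZl a u v : dot (a *: u) v = a * dot u v.
Proof. by rewrite /dot mulr_sumr; apply: eq_bigr => i _; rewrite !mxE mulrA. Qed.

Lemma dotNl u v : dot (- u) v = - dot u v.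
Proof. by rewrite -scaleN1r dotZl mulN1r. Qed.

Lemma dotDr u v w : dot u (v + w) = dot u v + dot u w.
Proof. by rewrite dotC dotDl !(dotC u). Qed.

Lemma dotZr a u v : dot u (a *: v) = a * dot u v.
Proof. by rewrite dotC dotZl dotC. Qed.

Lemma dotNr u v : dot u (- v) = - dot u v.
Proof. by rewrite dotC dotNl dotC. Qed.

Lemma dot_shift u v t :
  dot (u + t *: v) (u + t *: v) = dot u u + 2 * t * dot u v + t ^+ 2 * dot v v.
Proof. by rewrite dotDl !dotDr !dotZl !dotZr (dotC v u); ring. Qed.

Definition dotE := (dotDl, dotDr, dotNl, dotNr, dotZl, dotZr).

Lemma dot_ge0 u : 0 <= dot u u.
Proof. by apply: sumr_ge0 => i _; rewrite -expr2 sqr_ge0. Qed.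

Lemma dot_eq0 u : dot u u = 0 -> u = 0.
Proof.
move/eqP; rewrite psumr_eq0 => [/allP u0|i _]; last by rewrite -expr2 sqr_ge0.
apply/rowP => i; rewrite mxE; apply/eqP.
by have := u0 i (mem_index_enum _); rewrite mulf_eq0 orbb.
Qed.

Lemma enorm_ge0 u : 0 <= enorm u.
Proof. exact: sqrtr_ge0. Qed.

Lemma sqr_enorm u : enorm u ^+ 2 = dot u u.
Proof. exact/sqr_sqrtr/dot_ge0. Qed.

Lemma enorm0 : enorm (0 : 'rV[R]_n) = 0.
Proof. by rewrite /enorm -[0](scale0r 0) dotZl mul0r sqrtr0. Qed.

Lemma enormN u : enorm (- u) = enorm u.
Proof. by rewrite /enorm !dotE opprK. Qed.

Lemma enormB u v : enorm (u - v) = enorm (v - u).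
Proof. by rewrite -enormN opprB. Qed.

Lemma enormZ a u : enorm (a *: u) = `|a| * enorm u.
Proof.
by rewrite /enorm !dotE mulrA -expr2 sqrtrM ?sqr_ge0// sqrtr_sqr.
Qed.

(** Cauchy-Schwarz, from the nonnegative square of [dot v v *: u - dot u v *: v], a multiple of the
    component of [u] orthogonal to [v]. *)
Lemma dot_le_enorm u v : dot u v <= enorm u * enorm v.
Proof.
have [v0|v_neq0] := eqVneq (dot v v) 0.
  by rewrite (dot_eq0 v v0) enorm0 mulr0 -(scale0r 0) dotZr mul0r.
have v_gt0 : 0 < dot v v by rewrite lt_def v_neq0 dot_ge0.
have := dot_ge0 (dot v v *: u - dot u v *: v).
rewrite !dotE (dotC v u) => h.
have le_sq : dot u v ^+ 2 <= dot u u * dot v v.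
  by rewrite -(ler_pM2l v_gt0) -subr_ge0; apply: le_trans h _; lra.
apply: le_trans (ler_norm _) _.
by rewrite -sqrtrM ?dot_ge0// -sqrtr_sqr ler_wsqrtr.
Qed.

Lemma enormD u v : enorm (u + v) <= enorm u + enorm v.
Proof.
rewrite -(@ler_pXn2r _ 2) ?nnegrE ?addr_ge0 ?enorm_ge0//.
rewrite sqrrD !sqr_enorm !dotE (dotC v u).
have := dot_le_enorm u v; lra.
Qed.

Lemma cvg_dot {T : Type} {F : set_system T} {FF : Filter F}
    (f g : T -> 'rV[R]_n) u v :
  f @ F --> u -> g @ F --> v -> dot (f t) (g t) @[t --> F] --> dot u v.
Proof.
move=> fu gv; apply: cvg_big => [|i _]; first exact: add_continuous.
apply: cvgM; first exact: (cvg_comp _ _ fu (@coord_continuous _ _ _ 0 i u)).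
exact: (cvg_comp _ _ gv (@coord_continuous _ _ _ 0 i v)).
Qed.

Lemma cvg_enorm {T : Type} {F : set_system T} {FF : Filter F}
    (f : T -> 'rV[R]_n) u :
  f @ F --> u -> enorm (f t) @[t --> F] --> enorm u.
Proof.
by move=> fu; exact: (cvg_comp _ _ (cvg_dot _ _ _ _ fu fu) (@sqrt_continuous R _)).
Qed.

(** Compactness bounds [enorm] on [X], so that the [sup] in [diameter] is a true supremum and not a
    default value. *)
Lemma enorm_le_diameter (X : set 'rV[R]_n) u v :
  compact X -> X u -> X v -> enorm (u - v) <= diameter X.
Proof.
move=> Xc Xu Xv.
have enorm_cont : {within X, continuous (@enorm R n)}.
  apply: continuous_subspaceT => w.
  exact: (@cvg_enorm _ (nbhs w) _ id w (@cvg_id _ _)).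
have [c _ cmax] := compact_EVT_max (ex_intro _ u Xu) Xc enorm_cont.
apply: ub_le_sup; last by exists (u, v).
exists (enorm c + enorm c) => _ [[a b] [/= Xa Xb] <-].
apply: le_trans (enormD _ _) _; rewrite enormN.
by rewrite lerD// cmax ?inE.
Qed.

End EuclideanSpace.

(** * Sublinear functions and a finite-dimensional Hahn-Banach theorem *)

Section Sublinear.
Context {R : realType}.

Definition sublinear {E : lmodType R} (f : E -> R) : Prop :=
  (forall d e, f (d + e) <= f d + f e) /\
  (forall a d, 0 < a -> f (a *: d) <= a * f d).

Lemma sublinear0 {E : lmodType R} (f : E -> R) : sublinear f -> f 0 = 0.
Proof.
move=> [fD fZ]; apply/eqP; rewrite eq_le; apply/andP; split.
  by have := fZ 2^-1 0; rewrite scaler0 => /(_ ltac:(lra)); lra.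
by have := fD 0 0; rewrite addr0; lra.
Qed.

Lemma sublinearZ {E : lmodType R} (f : E -> R) a d :
  sublinear f -> 0 <= a -> f (a *: d) = a * f d.
Proof.
move=> fsub; rewrite le_eqVlt => /predU1P[<-|a0].
  by rewrite scale0r mul0r sublinear0.
have [_ fZ] := fsub; apply/eqP; rewrite eq_le fZ//=.
rewrite -ler_pdivlMl//; have := fZ a^-1 (a *: d).
by rewrite scalerA mulVf ?gt_eqF// scale1r; apply; rewrite invr_gt0.
Qed.

(** The minorant is an infimal convolution, the infimum over [k] in the convex cone [K] of
    [f (d + k.1) - k.2]. The choice [k = (0, 0)] gives [g <= f]; at [- k.1] the choice [k] leaves
    [- k.2]. It is used with a ray, to make a function linear in one direction, and with the cone
    generated by [X - xb], to split off a normal vector. *)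
Lemma sublinear_cone_minorant {E : lmodType R} (f : E -> R)
    (K : set (E * R)) :
  sublinear f -> K (0, 0) ->
  (forall k l, K k -> K l -> K (k.1 + l.1, k.2 + l.2)) ->
  (forall a k, 0 < a -> K k -> K (a *: k.1, a * k.2)) ->
  (forall k, K k -> k.2 <= f k.1) ->
  exists g : E -> R, [/\ sublinear g, forall d, g d <= f d &
    forall k, K k -> g (- k.1) <= - k.2].
Proof.
move=> fsub K0 KD KZ Kf; have [fD fZ] := fsub.
pose S d := [set f (d + k.1) - k.2 | k in K].
have Slb d : has_lbound (S d).
  (* Subadditivity gives [k.2 <= f k.1 <= f (d + k.1) + f (- d)]. *)
  exists (- f (- d)) => _ [k Kk <-].
  have := Kf _ Kk; have := fD (d + k.1) (- d).
  by rewrite addrAC subrr add0r; lra.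
have gS d k : K k -> inf (S d) <= f (d + k.1) - k.2.
  by move=> Kk; apply: ge_inf; [exact: Slb|exists k].
have le_g d c : (forall k, K k -> c <= f (d + k.1) - k.2) -> c <= inf (S d).
  move=> h; apply: lb_le_inf => [|_ [k Kk <-]]; last exact: h.
  by exists (f (d + 0) - 0); exists (0, 0).
exists (fun d => inf (S d)); split; first split.
- move=> d e; rewrite -lerBlDr; apply: (le_g d) => k Kk.
  rewrite lerBlDr -lerBlDl; apply: (le_g e) => l Kl.
  have := gS (d + e) _ (KD _ _ Kk Kl); rewrite /= addrACA.
  by have := fD (d + k.1) (e + l.1); lra.
- move=> a d a0; rewrite -ler_pdivrMl//; apply: (le_g d) => k Kk.
  rewrite ler_pdivrMl//.
  have := gS (a *: d) _ (KZ _ _ a0 Kk); rewrite /= -scalerDr.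
  by have := fZ a (d + k.1) a0; lra.
- by move=> d; have := gS d _ K0; rewrite /= addr0 subr0.
- by move=> k Kk; have := gS (- k.1) _ Kk; rewrite addNr (sublinear0 _ fsub) sub0r.
Qed.

(** Induction on [s], with [K] the ray through [(e, g e)]. Passing to a smaller sublinear [h] keeps
    linearity in the directions already treated: [h (- u) <= g (- u) <= - g u <= - h u]. *)
Lemma sublinear_linear_along {E : lmodType R} (f : E -> R) (s : seq E) :
  sublinear f ->
  exists g : E -> R, [/\ sublinear g, forall d, g d <= f d &
    forall e, e \in s -> g (- e) <= - g e].
Proof.
move=> fsub; elim: s => [|e s [g [gsub gf gs]]]; first by exists f.
have [gD gZ] := gsub.
pose K := [set (t *: e, t * g e) | t in [set t : R | 0 <= t]].
have [||||h [hsub hg hK]] := @sublinear_cone_minorant E g K gsub.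
- by exists 0 => //=; rewrite scale0r mul0r.
- move=> _ _ [t /= t0 <-] [u /= u0 <-] /=.
  by exists (t + u); rewrite /= ?addr_ge0// scalerDl mulrDl.
- move=> a _ a0 [t /= t0 <-] /=.
  by exists (a * t); rewrite /= ?scalerA ?mulrA// mulr_ge0// ltW.
- by move=> _ [t /= t0 <-] /=; rewrite (sublinearZ _ _ _ gsub).
exists h; split=> // [d|u]; first exact: le_trans (hg d) (gf d).
rewrite inE => /predU1P[->|us].
  have /hK : K (e, g e) by exists 1; rewrite /= ?scale1r ?mul1r.
  by move=> /= hle; have := hg e; lra.
by have := hg (- u); have := hg u; have := gs u us; lra.
Qed.

(** A sublinear function that is linear along each basis vector is linear, so finitely many
    directions are enough. *)
Lemma sublinear_dot_minorant {n : nat} (f : 'rV[R]_n -> R) :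
  sublinear f -> exists v, forall d, dot v d <= f d.
Proof.
move=> fsub; pose b (i : 'I_n) : 'rV[R]_n := delta_mx 0 i.
have [g [gsub gf gb]] := sublinear_linear_along f [seq b i | i <- enum 'I_n] fsub.
have [gD gZ] := gsub; exists (\row_i g (b i)).
have g_le d : g d <= dot (\row_i g (b i)) d.
  rewrite [in leLHS](row_sum_delta d) /dot.
  apply: (big_ind2 (fun x y => g x <= y)) => [|x1 x2 y1 y2 h1 h2|i _].
  - by rewrite (sublinear0 _ gsub).
  - by apply: le_trans (gD _ _) _; rewrite lerD.
  - rewrite mxE mulrC; have [di0|di0|->] := ltgtP (d 0 i) 0.
    (* For a negative coordinate, [d 0 i *: b i] is a positive multiple of [- b i], where linearity
       along [b i] applies. *)
    + have := gb (b i) (map_f _ (mem_enum _ i)).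
      have := gZ (- d 0 i) (- b i); rewrite oppr_gt0 di0 scaleNr scalerN opprK.
      move=> /(_ isT) h1 h2; apply: le_trans h1 _.
      nra.
    + exact: gZ.
    + by rewrite scale0r mul0r (sublinear0 _ gsub).
(* The bound [g_le] at [- d] and [0 <= g d + g (- d)] give the reverse inequality. *)
move=> d; apply: le_trans (gf d).
have := g_le (- d); have := gD d (- d); rewrite subrr (sublinear0 _ gsub) dotNr.
by lra.
Qed.

End Sublinear.

(** * The Clarke directional derivative of a Lipschitz function *)

Section ClarkeDerivative.
Context {R : realType} {n : nat}.
Implicit Types (f : 'rV[R]_n -> R) (x d : 'rV[R]_n).

Definition diff_quotient f d (p : 'rV[R]_n * R) : R :=
  (f (p.1 + p.2 *: d) - f p.1) / p.2.

Definition clarke_filter x := filter_prod (nbhs x) (0 : R)^'+.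

#[local] Instance clarke_filter_proper x : ProperFilter (clarke_filter x).
Proof. exact: filter_prod_proper. Qed.

#[local] Typeclasses Opaque clarke_filter.

Lemma clarke_derivative_le f x d c :
  (\forall p \near clarke_filter x, diff_quotient f d p <= c) ->
  (clarke_derivative f x d <= c%:E)%E.
Proof.
move=> near_le; apply: ge_ereal_inf.
exists (ereal_sup [set (diff_quotient f d p)%:E |
                   p in [set p | diff_quotient f d p <= c]]).
  by exists [set p | diff_quotient f d p <= c].
by apply: ge_ereal_sup => _ [p /= pc <-]; rewrite lee_fin.
Qed.

Lemma clarke_derivative_lt f x d c :
  (clarke_derivative f x d < c%:E)%E ->
  \forall p \near clarke_filter x, diff_quotient f d p < c.
Proof.
move=> /ereal_inf_lt[_ [A FA <-] Ac]; apply: filterS FA => p Ap.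
by rewrite -lte_fin; apply: le_lt_trans Ac; apply: ereal_sup_ubound; exists p.
Qed.

Definition lipschitz_near f x : Prop :=
  exists (U : set 'rV[R]_n) (L : R), nbhs x U /\
    forall y z, U y -> U z -> `|f y - f z| <= L * enorm (y - z).

Lemma lipschitz_near_continuous f x :
  lipschitz_near f x -> {for x, continuous f}.
Proof.
move=> [U [L [xU UL]]]; apply/(@cvgrPdist_lt _ _ _ (nbhs x) (nbhs_filter x)) => e e0.
have xy : x - y @[y --> x] --> x - x.
  by apply: continuousB; [exact: cst_continuous|move=> ?].
have : L * enorm (x - y) @[y --> x] --> L * enorm (x - x).
  exact: (cvgMl_tmp (cvg_enorm _ _ xy)).
rewrite subrr enorm0 mulr0 => /cvgr_lt/(_ _ e0).
move=> Le; near=> y; apply: (@le_lt_trans _ _ (L * enorm (x - y))).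
  by apply: UL; [exact: nbhs_singleton xU|near: y].
by near: y.
Unshelve. all: by end_near. Qed.

#[local] Instance clarke_filter_filter x : Filter (clarke_filter x).
Proof. exact: filter_filter. Qed.

Let cvg_clarke_filter {T : Type} {F : set_system T} {FF : Filter F}
    (h : T -> 'rV[R]_n) (k : T -> R) x :
  h @ F --> x -> k @ F --> (0 : R)^'+ -> (h t, k t) @[t --> F] --> clarke_filter x.
Proof. by move=> hx k0; exact: (cvg_pair hx k0). Qed.

Let cvg_point x : p.1 @[p --> clarke_filter x] --> x.
Proof. exact: cvg_fst. Qed.

Let cvg_length x : p.2 @[p --> clarke_filter x] --> (0 : R)^'+.
Proof. exact: cvg_snd. Qed.

Let cvg_step x d :
  p.1 + p.2 *: d @[p --> clarke_filter x] --> x.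
Proof.
rewrite -[X in _ --> X]addr0 -(scale0r d); apply: cvgD; first exact: cvg_point.
by apply: cvgZr_tmp => A A0; apply: cvg_length; exact: cvg_within A0.
Qed.

Let near_gt0 x : \forall p \near clarke_filter x, 0 < p.2.
Proof. exact: (@cvg_length x _ (nbhs_right_gt (0 : R))). Qed.

Lemma near_diff_quotient_le {f x} d : lipschitz_near f x ->
  exists L, \forall p \near clarke_filter x, `|diff_quotient f d p| <= L.
Proof.
move=> [U [L [xU UL]]]; exists (L * enorm d).
near=> p; have p0 : 0 < p.2 by near: p; exact: near_gt0.
rewrite /diff_quotient normrM normfV (gtr0_norm p0) ler_pdivrMr//.
have Up : U p.1 by near: p; exact: cvg_point xU.
have Upd : U (p.1 + p.2 *: d) by near: p; exact: cvg_step xU.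
apply: le_trans (UL _ _ Upd Up) _.
by rewrite addrAC subrr add0r enormZ (gtr0_norm p0) mulrA mulrAC.
Unshelve. all: by end_near. Qed.

(** Nearby difference quotients lie in an interval [[- L, L]], which bounds their limsup on both
    sides; [fine] then loses nothing. *)
Lemma clarke_derivative_fin_num f x d : lipschitz_near f x ->
  clarke_derivative f x d \is a fin_num.
Proof.
move=> /(near_diff_quotient_le d)[L fL]; rewrite fin_real//; apply/andP; split.
  apply: (@lt_le_trans _ _ (- L - 1)%:E); first exact: ltNyr.
  rewrite leNgt; apply/negP => /clarke_derivative_lt lt_near.
  have [p []] := filter_ex (filterI fL lt_near).
  by rewrite ler_norml => /andP[]; lra.
apply: (@le_lt_trans _ _ L%:E); last exact: ltry.
by apply: clarke_derivative_le; apply: filterS fL => p; exact/le_trans/ler_norm.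
Qed.

Section Sublinearity.
Variables (f : 'rV[R]_n -> R) (x : 'rV[R]_n).
Hypothesis f_lip : lipschitz_near f x.

Let g d := fine (clarke_derivative f x d).

Lemma fine_clarke_derivative_le d c :
  (\forall p \near clarke_filter x, diff_quotient f d p <= c) -> g d <= c.
Proof.
by move=> /clarke_derivative_le; rewrite -lee_fin fineK// clarke_derivative_fin_num.
Qed.

Lemma near_diff_quotient_lt d {e} : 0 < e ->
  \forall p \near clarke_filter x, diff_quotient f d p < g d + e.
Proof.
move=> e0; apply: clarke_derivative_lt; rewrite -[X in (X < _)%E]fineK.
  by rewrite lte_fin ltrDl.
exact: clarke_derivative_fin_num.
Qed.

(** The quotient along [d1 + d2] at [y] is the quotient along [d2] at [y + t *: d1] plus the one
    along [d1] at [y]. Since base points vary in the limsup, the shifted pair still follows the same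
    filter. Homogeneity comes from replacing [t] by [a * t]. *)
Lemma clarke_derivative_sublinear : sublinear g.
Proof.
split=> [d1 d2|a d a0].
  apply/ler_addgt0Pr => e e0; apply: fine_clarke_derivative_le.
  have shift : (p.1 + p.2 *: d1, p.2) @[p --> clarke_filter x] -->
      clarke_filter x by exact: cvg_clarke_filter (cvg_step x d1) (cvg_length x).
  have e20 : 0 < e / 2 by rewrite divr_gt0.
  near=> p; have p0 : 0 < p.2 by near: p; exact: near_gt0.
  have h1 : diff_quotient f d1 p < g d1 + e / 2.
    by near: p; exact: (near_diff_quotient_lt d1 e20).
  have h2 : diff_quotient f d2 (p.1 + p.2 *: d1, p.2) < g d2 + e / 2.
    by near: p; exact: (shift _ (near_diff_quotient_lt d2 e20)).
  have -> : diff_quotient f (d1 + d2) p =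
      diff_quotient f d2 (p.1 + p.2 *: d1, p.2) + diff_quotient f d1 p.
    by rewrite /diff_quotient /= scalerDr addrA; field; lra.
  by lra.
apply/ler_addgt0Pr => e e0; apply: fine_clarke_derivative_le.
have scale : a * p.2 @[p --> clarke_filter x] --> (0 : R)^'+.
  apply: cvg_comp (cvg_length x) _ => P [r /= r0 rP]; exists (r / a) => /=.
    by rewrite divr_gt0.
  move=> t /=; rewrite !sub0r !normrN => ta t0; apply: rP; last by rewrite mulr_gt0.
  by rewrite /= sub0r normrN normrM (gtr0_norm a0) mulrC -ltr_pdivlMr.
have dilate : (p.1, a * p.2) @[p --> clarke_filter x] --> clarke_filter x.
  exact: cvg_clarke_filter (cvg_point x) scale.
have ea0 : 0 < e / a by rewrite divr_gt0.
near=> p; have p0 : 0 < p.2 by near: p; exact: near_gt0.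
have h : diff_quotient f d (p.1, a * p.2) < g d + e / a.
  by near: p; exact: (dilate _ (near_diff_quotient_lt d ea0)).
have -> : diff_quotient f (a *: d) p = a * diff_quotient f d (p.1, a * p.2).
  rewrite /diff_quotient /= scalerA (mulrC p.2); field.
  by rewrite !gt_eqF.
have -> : a * g d + e = a * (g d + e / a) by field; rewrite gt_eqF.
by rewrite ler_pM2l// ltW.
Unshelve. all: by end_near. Qed.

(** The limsup dominates the quotients with base point frozen at [x], and the error [M * t] vanishes
    in the limit. *)
Lemma le_fine_clarke_derivative d c M :
  (\forall t \near (0 : R)^'+, c - M * t <= diff_quotient f d (x, t)) ->
  c <= g d.
Proof.
move=> near_ge; apply/ler_addgt0Pr => e e0.
have e20 : 0 < e / 2 by rewrite divr_gt0.
have [[A B] [/= xA B0] AB] := near_diff_quotient_lt d e20.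
have : \forall t \near (0 : R)^'+, M * t < e / 2.
  have : M * t @[t --> (0 : R)^'+] --> M * 0.
    by apply: cvgMl_tmp; exact: cvg_within.
  by rewrite mulr0 => /cvgr_lt; apply.
move=> /(filterI B0)/(filterI near_ge)/filter_ex[t [/= h1 [Bt h2]]].
have := AB (x, t) (conj (nbhs_singleton xA) Bt); rewrite /=; lra.
Qed.

End Sublinearity.

End ClarkeDerivative.

(** * Stationarity from a proximal inequality *)

Section Stationarity.
Context {R : realType} {n : nat}.
Variables (X : set 'rV[R]_n) (theta : 'rV[R]_n -> R).
Hypothesis Xconvex : convex_set X.

Lemma convex_set_segment y z t :
  X y -> X z -> 0 <= t -> t <= 1 -> X (z + t *: (y - z)).
Proof.
move=> Xy Xz t0 t1.
have t01 : Itv.spec (@Itv.num_sem R) (Itv.Real `[0, 1]%Z) t.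
  by rewrite /Itv.num_sem/= num_real/= in_itv/= t0.
have := Xconvex y z (Itv.mk t01) (mem_set Xy) (mem_set Xz); rewrite inE.
congr X; rewrite /conv /= /unstable.onem.
by rewrite scalerBl scale1r scalerBr addrCA addrA.
Qed.

Lemma convex_function_segment f y z t :
  convex_function X f -> X y -> X z -> 0 <= t -> t <= 1 ->
  f (z + t *: (y - z)) <= f z + t * (f y - f z).
Proof.
move=> fconv Xy Xz t0 t1.
have t01 : Itv.spec (@Itv.num_sem R) (Itv.Real `[0, 1]%Z) t.
  by rewrite /Itv.num_sem/= num_real/= in_itv/= t0.
have := fconv (Itv.mk t01) y z (mem_set Xy) (mem_set Xz).
rewrite convRE [X in f X]/conv /= /unstable.onem => h.
have -> : z + t *: (y - z) = t *: y + (1 - t) *: z.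
  by rewrite scalerBl scale1r scalerBr addrCA addrA.
by apply: le_trans h _; lra.
Qed.

(** On segments from [xb] into [X] the quadratic error is of second order, so the Clarke derivative
    [g] dominates [dot p] on [X - xb]. A linear function below [g] and above [dot p] on [X - xb] is
    then a Clarke subgradient [v] with [p - v] normal. *)
Lemma proximal_subgradient_stationary xb p M :
  X xb -> lipschitz_near theta xb ->
  (forall y, X y ->
    theta xb + dot p (y - xb) - M * dot (y - xb) (y - xb) <= theta y) ->
  stationarity_set X theta xb p.
Proof.
move=> Xxb lip prox.
pose g d := fine (clarke_derivative theta xb d).
have gsub : sublinear g by exact: clarke_derivative_sublinear.
have g_ge y : X y -> dot p (y - xb) <= g (y - xb).
  move=> Xy; set d := y - xb.
  apply: (@le_fine_clarke_derivative _ _ _ _ lip _ _ (M * dot d d)).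
  near=> t; have t0 : 0 < t by near: t; exact: nbhs_right_gt.
  have t1 : t <= 1 by near: t; exact: nbhs_right_le.
  rewrite /diff_quotient /= ler_pdivlMr//.
  have := prox _ (convex_set_segment y xb t Xy Xxb (ltW t0) t1).
  rewrite -/d (addrC xb) addrK !dotE.
  by lra.
(* The graph of [dot p] over the cone generated by [X - xb]. *)
pose K := [set k : 'rV[R]_n * R | exists t y, [/\ 0 <= t, X y &
  k = (t *: (y - xb), t * dot p (y - xb))]].
have [||||h [hsub hg hK]] := @sublinear_cone_minorant R _ g K gsub.
- by exists 0, xb; split=> //; rewrite scale0r mul0r.
- move=> _ _ [t [y [t0 Xy ->]]] [u [z [u0 Xz ->]]] /=.
  have [/eqP|tu_neq0] := eqVneq (t + u) 0.
    rewrite paddr_eq0// => /andP[/eqP -> /eqP ->].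
    by exists 0, xb; split=> //; rewrite !scale0r !mul0r !addr0.
  have tu_gt0 : 0 < t + u by rewrite lt_def tu_neq0 addr_ge0.
  (* Convexity of [X] makes the cone closed under sums: the new point is the average of [y] and [z]
     with weights proportional to [t] and [u]. *)
  exists (t + u), (z + (t / (t + u)) *: (y - z)); split; first exact: ltW.
    apply: convex_set_segment => //; first by rewrite divr_ge0// ltW.
    by rewrite ler_pdivrMr// mul1r lerDl.
  have combination : t *: (y - xb) + u *: (z - xb) =
      (t + u) *: (z + (t / (t + u)) *: (y - z) - xb).
    by apply/rowP => i; rewrite !mxE; field.
  by rewrite -!dotZr -dotDr combination.
- move=> a _ a0 [t [y [t0 Xy ->]]] /=; exists (a * t), y.
  by split=> //; [rewrite mulr_ge0// ltW|rewrite scalerA mulrA].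
- move=> _ [t [y [t0 Xy ->]]] /=; rewrite (sublinearZ _ _ _ gsub t0).
  by rewrite ler_wpM2l// g_ge.
have [v vh] := sublinear_dot_minorant _ hsub.
exists v.
  move=> d; rewrite -[X in (_ <= X)%E]fineK ?clarke_derivative_fin_num//.
  by rewrite lee_fin; apply: le_trans (vh d) (hg d).
(* With [d = y - xb], normality is [- dot v d <= h (- d) <= - dot p d]. *)
exists (p - v); last by rewrite addrC subrK.
move=> y Xy; rewrite dotDl dotNl.
have /hK /= : K (y - xb, dot p (y - xb)).
  by exists 1, y; split=> //; rewrite scale1r mul1r.
by have := vh (- (y - xb)); rewrite dotNr; lra.
Unshelve. all: by end_near. Qed.
End Stationarity.

(** * Approximately stationary points from a penalized problem *)

Section ApproximateStationarity.
Context {R : realType} {n : nat}.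
Variables (X : set 'rV[R]_n) (theta : 'rV[R]_n -> R).
Hypotheses (Xcompact : compact X) (Xconvex : convex_set X).
Hypothesis theta_lip : locally_lipschitz X theta.

Lemma exists_minimizer (h : 'rV[R]_n -> R) :
  X !=set0 -> (forall y, X y -> {for y, continuous h}) ->
  argmin X (fun y => theta y + h y) !=set0.
Proof.
move=> X0 hcont.
have [] := compact_EVT_min X0 Xcompact (f := fun y => theta y + h y).
  rewrite continuous_subspace_in => y; rewrite inE => Xy.
  apply: continuous_subspaceT_for => //; apply: continuousD; last exact: hcont.
  exact/lipschitz_near_continuous/theta_lip.
move=> c Xc cmin; exists c; split=> [|y Xy]; first by rewrite -inE.
by apply: cmin; rewrite inE.
Qed.

(* The bound 5/2 comes from [s^2 (s - 2) <= (s - 1)^2 / 2] for [s <= 2] (here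
   with [r = 1]) and [2 k s <= r]. *)
Lemma penalty_slope_le (r s : R) : 0 < r -> 0 <= s -> s <= 2 * r ->
  2 * (1 / 2 + 2 * (r ^+ 2) ^+ 2 / (r ^+ 2 + s ^+ 2) ^+ 2) * s <= 5 / 2 * r.
Proof.
move=> r0 s0 sr; have r20 : 0 < r ^+ 2 by rewrite exprn_gt0.
have d0 : 0 < r ^+ 2 + s ^+ 2 by rewrite ltr_pwDl// sqr_ge0.
pose k := r ^+ 2 / (r ^+ 2 + s ^+ 2).
have k0 : 0 < k by rewrite divr_gt0.
have kE : k * (r ^+ 2 + s ^+ 2) = r ^+ 2 by rewrite mulfVK ?gt_eqF.
have -> : 2 * (r ^+ 2) ^+ 2 / (r ^+ 2 + s ^+ 2) ^+ 2 = 2 * k ^+ 2.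
  by rewrite /k; field; rewrite gt_eqF.
have h1 : 2 * k * s <= r.
  rewrite -(ler_pM2r d0).
  have -> : 2 * k * s * (r ^+ 2 + s ^+ 2) = 2 * s * (k * (r ^+ 2 + s ^+ 2)) by ring.
  by rewrite kE; have := mulr_ge0 (ltW r0) (sqr_ge0 (r - s)); lra.
have h2 : s + 2 * k * r <= 5 / 2 * r.
  rewrite -(ler_pM2r d0).
  have -> : (s + 2 * k * r) * (r ^+ 2 + s ^+ 2) =
     s * (r ^+ 2 + s ^+ 2) + 2 * r * (k * (r ^+ 2 + s ^+ 2)) by ring.
  rewrite kE.
  have a1 := mulr_ge0 (ltW r0) (sqr_ge0 (r - s)).
  have a2 : 0 <= (2 * r - s) * s ^+ 2 by rewrite mulr_ge0 ?sqr_ge0// subr_ge0.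
  by lra.
have : 2 * k * (2 * k * s) <= 2 * k * r by rewrite ler_pM2l// mulr_gt0.
by lra.
Qed.

(** Tangent-line inequality for a concave function of [q]; the gap is a square divided by the
    positive [w + q']. *)
Lemma penalty_concave (w q q' : R) : 0 < w -> 0 <= q -> 0 <= q' ->
  2 * w * q' / (w + q') <=
  2 * w * q / (w + q) + 2 * w ^+ 2 / (w + q) ^+ 2 * (q' - q).
Proof.
move=> w0 q0 q'0.
have wq : 0 < w + q by rewrite ltr_pwDl.
have wq' : 0 < w + q' by rewrite ltr_pwDl.
rewrite -subr_ge0; set lhs := (X in 0 <= X).
have -> : lhs = 2 * (w * (q' - q) / (w + q)) ^+ 2 / (w + q').
  by rewrite /lhs; field; rewrite !gt_eqF.
by rewrite divr_ge0 ?(ltW wq')// mulr_ge0// sqr_ge0.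
Qed.

Lemma approximate_stationary (g x z : 'rV[R]_n) (kappa : R) :
  0 < kappa -> X x -> X z ->
  (forall y, X y -> theta z <=
     theta y + dot g (y - z) + kappa / 2 * dot (y - x) (y - x)) ->
  exists xb p, [/\ X xb, stationarity_set X theta xb p,
    enorm (xb - x) <= 2 * enorm (z - x) &
    enorm p <= enorm g + 5 / 2 * kappa * enorm (z - x)].
Proof.
move=> kappa0 Xx Xz zmin.
(* If [z = x] the penalty degenerates, but the hypothesis is then itself a proximal inequality at
   [x] with subgradient [- g]. *)
have [zx|r_neq0] := eqVneq (enorm (z - x)) 0.
  have {}zx : z = x.
    by apply/subr0_eq/dot_eq0; rewrite -sqr_enorm zx expr0n.
  exists x, (- g); rewrite zx subrr enorm0 !mulr0 addr0 enormN; split=> //.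
  apply: (@proximal_subgradient_stationary _ _ _ _ Xconvex _ _ (kappa / 2)) => //.
    exact: theta_lip.
  by move=> y Xy; have := zmin y Xy; rewrite zx dotNl; lra.
set r := enorm (z - x) in r_neq0 *.
have r0 : 0 < r by rewrite lt_def r_neq0 enorm_ge0.
pose w := r ^+ 2; have w0 : 0 < w by rewrite exprn_gt0.
pose q y := dot (y - x) (y - x).
have q_ge0 y : 0 <= q y by exact: dot_ge0.
have qz : q z = w by rewrite /w sqr_enorm.
have wq0 y : 0 < w + q y by rewrite ltr_pwDl.
(* The term [q y / 2] matches the quadratic error in [zmin]; the other term, increasing in [q y],
   keeps the minimizer near [x]. *)
pose h y := dot g y + kappa * (q y / 2 + 2 * w * q y / (w + q y)).
have [xb [Xxb xbmin]] : argmin X (fun y => theta y + h y) !=set0.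
  apply: exists_minimizer; first by exists x.
  move=> y Xy.
  have idy : u @[u --> y] --> y by exact: cvg_id.
  have qcont : q u @[u --> y] --> q y.
    have : u - x @[u --> y] --> y - x.
      by apply: continuousB; [move=> ?|exact: cst_continuous].
    by move=> c; exact: (cvg_dot _ _ _ _ c c).
  have gcont : dot g u @[u --> y] --> dot g y.
    exact: (cvg_dot _ _ _ _ (@cst_continuous _ _ g y) idy).
  have wcont : w + q u @[u --> y] --> w + q y.
    exact: (cvgD (@cst_continuous _ _ w y) qcont).
  have wVcont : (w + q u)^-1 @[u --> y] --> (w + q y)^-1.
    by apply: cvgV wcont; rewrite gt_eqF.
  have pcont : 2 * w * q u / (w + q u) @[u --> y] --> 2 * w * q y / (w + q y).
    exact: (cvgM (cvgMl_tmp qcont) wVcont).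
  exact: (cvgD gcont (cvgMl_tmp (cvgD (cvgMr_tmp qcont) pcont))).
(* Adding [xbmin] at [z] to [zmin] at [xb] cancels [theta], [g] and [q xb / 2]. What is left is
   [2 * w * u <= 3 / 2 * w], as the penalty at [z] is [w / 2 + w]. *)
have qxb : q xb <= 3 * w.
  have := xbmin z Xz; rewrite /h qz => xbz; have xb_ge := zmin xb Xxb.
  pose u := q xb / (w + q xb).
  have uE : u * (w + q xb) = q xb by rewrite mulfVK ?gt_eqF.
  have : u <= 3 / 4.
    have e1 : 2 * w * q xb / (w + q xb) = 2 * w * u by rewrite /u mulrA.
    have e2 : 2 * w * w / (w + w) = w.
      have ww : w + w != 0 by rewrite gt_eqF ?addr_gt0.
      by apply: (canLR (mulfK ww)); ring.
    move: xbz xb_ge; rewrite e1 e2 dotDr dotNr -/(q xb) => xbz xb_ge.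
    rewrite -(ler_pM2l (mulr_gt0 kappa0 w0)).
    by lra.
  by rewrite -(ler_pM2r (wq0 xb)) uE; lra.
(* The derivative in [q] of the penalty at [q xb]; the witness [p] below is minus the gradient of
   [h] at [xb]. *)
pose m := 1 / 2 + 2 * w ^+ 2 / (w + q xb) ^+ 2.
exists xb, (- (g + (2 * (kappa * m)) *: (xb - x))).
have sqE : enorm (xb - x) ^+ 2 = q xb by exact: sqr_enorm.
have xb_near : enorm (xb - x) <= 2 * r.
  rewrite -(@ler_pXn2r _ 2) ?nnegrE ?enorm_ge0 ?mulr_ge0 ?enorm_ge0//.
  by rewrite sqE exprMn -/w; lra.
split=> //.
  apply: (@proximal_subgradient_stationary _ _ _ _ Xconvex _ _ (kappa * m)) => //.
    exact: theta_lip.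
  (* Concavity bounds the penalty by its tangent in [q], and expanding [q y] around [xb] leaves the
     quadratic error [kappa * m]. *)
  move=> y Xy; have := xbmin y Xy; rewrite /h => le_y.
  have concave := penalty_concave w (q xb) (q y) w0 (q_ge0 xb) (q_ge0 y).
  have qy : q y = q xb + 2 * dot (xb - x) (y - xb) + dot (y - xb) (y - xb).
    have -> : q y = q (xb + 1 *: (y - xb)) by rewrite scale1r subrKC.
    by rewrite /q addrAC dot_shift expr1n !mul1r mulr1.
  have {}concave : q y / 2 + 2 * w * q y / (w + q y) <=
      q xb / 2 + 2 * w * q xb / (w + q xb) + m * (q y - q xb).
    by rewrite /m; lra.
  rewrite -(ler_pM2l kappa0) qy in concave.
  rewrite dotNl [dot (g + _) _]dotDl dotZl [dot g (y - xb)]dotDr dotNr.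
  rewrite qy in le_y; lra.
rewrite enormN; apply: le_trans (enormD _ _) _; rewrite lerD2l enormZ.
have m0 : 0 <= m by rewrite addr_ge0// divr_ge0 ?sqr_ge0// mulr_ge0 ?sqr_ge0.
rewrite ger0_norm; last by rewrite !mulr_ge0// ltW.
have := penalty_slope_le r (enorm (xb - x)) r0 (enorm_ge0 _) xb_near.
by rewrite sqE -/w -/m -(ler_pM2l kappa0); lra.
Qed.

End ApproximateStationarity.

(** * Optimality of the surrogate minimizer and the error bound *)

Lemma dist_le {R : realType} {n : nat} (x a : 'rV[R]_n) (A : set 'rV[R]_n) :
  A a -> (dist x A <= (enorm (x - a))%:E)%E.
Proof. by move=> Aa; apply: ereal_inf_lbound; exists a. Qed.

Lemma dist_triangle {R : realType} {n : nat} (x y : 'rV[R]_n)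
    (A : set 'rV[R]_n) :
  (dist x A <= (enorm (x - y))%:E + dist y A)%E.
Proof.
rewrite -leeBlDl//; apply: le_ereal_inf_tmp => _ [a Aa <-].
rewrite leeBlDl//; apply: le_trans (dist_le x a A Aa) _.
by rewrite -EFinD lee_fin -(subrKA y); exact: enormD.
Qed.

(** A minimizer [c] of [theta] also minimizes its own surrogate, as
    [V y c >= theta y >= theta c = V c c], and (SR2) applies. This keeps the distance to the
    stationary set finite when (LEB) cannot be invoked. *)
Lemma C_stationary_neq0 {R : realType} {n : nat} (X : set 'rV[R]_n)
    (theta : 'rV[R]_n -> R) (V : 'rV[R]_n -> 'rV[R]_n -> R) (kappa : R) :
  compact X -> locally_lipschitz X theta ->
  SR1 X theta V kappa -> SR2 X theta V ->
  X !=set0 -> C_stationary X theta !=set0.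
Proof.
move=> Xcompact theta_lip hSR1 hSR2 X0.
have [c [Xc cmin]] := exists_minimizer _ _ Xcompact theta_lip (fun=> 0) X0
  (fun y _ => @cst_continuous _ _ 0 y).
exists c; apply: hSR2; split=> //; split=> // y Xy.
have [_ -> V_ge _] := hSR1 c Xc.
by have := cmin y Xy; rewrite !addr0 => /le_trans; apply; exact: V_ge.
Qed.

(** First-order optimality without differentiating [V]: compare [z] with [z + t *: (y - z)], divide
    by [t], and make [t] small. *)
Lemma reg_surrogate_argmin_linearized {R : realType} {n : nat}
    (X : set 'rV[R]_n) (V : 'rV[R]_n -> 'rV[R]_n -> R) (rho : R)
    (x z y : 'rV[R]_n) :
  convex_set X -> convex_function X (V ^~ x) -> 0 < rho ->
  argmin X (reg_surrogate V rho ^~ x) z -> X y ->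
  V z x <= V y x + dot (rho^-1 *: (z - x)) (y - z).
Proof.
move=> Xconvex Vconvex rho0 [Xz zmin] Xy; set lin := dot _ _.
(* After division by [t] the quadratic remainder is [t * c]; [t = e / (e + c)] keeps [t <= 1] and
   makes it at most [e]. *)
apply/ler_addgt0Pr => e e0; pose c := rho^-1 / 2 * dot (y - z) (y - z).
have c0 : 0 <= c by rewrite mulr_ge0 ?dot_ge0// divr_ge0// invr_ge0 ltW.
pose t := e / (e + c); have ec : 0 < e + c by rewrite ltr_pwDl.
have t0 : 0 < t by rewrite divr_gt0.
have t1 : t <= 1 by rewrite ler_pdivrMr// mul1r lerDl.
have tc : t * c <= e.
  by rewrite mulrAC ler_pdivrMr// ler_pM2l// lerDr ltW.
have := zmin _ (convex_set_segment X Xconvex y z t Xy Xz (ltW t0) t1).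
have := convex_function_segment X _ y z t Vconvex Xy Xz (ltW t0) t1.
rewrite /reg_surrogate !sqr_enorm /= => V_le.
have -> : z + t *: (y - z) - x = (z - x) + t *: (y - z) by rewrite addrAC.
have -> : 1 / (2 * rho) = rho^-1 / 2 by rewrite invfM mul1r mulrC.
rewrite dot_shift.
move=> le_z; rewrite -(ler_pM2l t0).
have linE : lin = rho^-1 * dot (z - x) (y - z) by rewrite /lin dotZl.
have := ler_wpM2l (ltW t0) tc; rewrite /c linE.
by lra.
Qed.

(** Existence of the regularized minimizer is assumed at [x], so that [surrogate_map] returns it and
    not a default. *)
Theorem theorem9 (R : realType) (n : nat) (X : set 'rV[R]_n)
    (theta : 'rV[R]_n -> R) (V : 'rV[R]_n -> 'rV[R]_n -> R)
    (eps eta kappa : R)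
    (Xcompact : compact X) (Xconvex : convex_set X)
    (theta_lip : locally_lipschitz X theta)
    (eps_gt0 : 0 < eps) (eta_gt0 : 0 < eta) (kappa_gt0 : 0 < kappa)
    (hLEB : LEB X theta eps eta)
    (hSR1 : SR1 X theta V kappa)
    (hSR2 : SR2 X theta V) :
  forall rho : R, 0 < rho ->
  let D := diameter X in
  let etahat :=
    Num.max (2 + eta * (2 / rho + 5 * kappa / 2))
            (2 * D / eps * (2 / rho + 5 * kappa / 2)) in
  forall x : 'rV[R]_n, X x ->
    argmin X (reg_surrogate V rho ^~ x) !=set0 ->
    (dist x (C_stationary X theta)
       <= (etahat * surrogate_residual X V rho x)%:E)%E.
Proof.
move=> rho rho0 D etahat x Xx argmin0.
rewrite /surrogate_residual; set z := surrogate_map X V rho x.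
have zargmin : argmin X (reg_surrogate V rho ^~ x) z by exact: getPex.
have [Xz _] := zargmin; have [Vconvex _ V_ge V_le] := hSR1 x Xx.
pose B := 2 / rho + 5 * kappa / 2; set r := enorm (x - z).
have r0 : 0 <= r by exact: enorm_ge0.
have B0 : 0 <= B by rewrite addr_ge0// divr_ge0// ?mulr_ge0// ltW.
have [|xb [p [Xxb statp xb_near p_le]]] :=
    approximate_stationary X theta Xcompact Xconvex theta_lip
      (rho^-1 *: (z - x)) x z kappa kappa_gt0 Xx Xz.
  move=> y Xy.
  have := reg_surrogate_argmin_linearized X V rho x z y Xconvex Vconvex rho0
    zargmin Xy.
  have := V_ge z Xz; have := V_le y Xy; rewrite sqr_enorm; lra.
rewrite (enormB z x) -/r in xb_near p_le.
have {}p_le : enorm p <= B * r.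
  apply: le_trans p_le _; rewrite enormZ (enormB z x) -/r.
  rewrite ger0_norm; last by rewrite invr_ge0 ltW.
  (* The slack between the [1 / rho] obtained and the [2 / rho] in [B]. *)
  have : 0 <= rho^-1 * r by rewrite mulr_ge0// invr_ge0 ltW.
  by rewrite /B; lra.
have res_le : (C_residual X theta xb <= (B * r)%:E)%E.
  apply: le_trans (dist_le 0 p _ statp) _.
  by rewrite sub0r enormN lee_fin.
have [Br_le|Br_gt] := leP (B * r) eps.
  apply: le_trans (dist_triangle x xb _) _.
  apply: (@le_trans _ _ ((2 * r)%:E + eta%:E * (B * r)%:E)%E).
    apply: leeD; first by rewrite lee_fin enormB.
    apply: le_trans (hLEB xb Xxb _) _; first exact: le_trans res_le _.
    by rewrite lee_wpmul2l// lee_fin ltW.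
  rewrite -EFinM -EFinD lee_fin mulrA -mulrDl ler_wpM2r//.
  by rewrite /etahat le_max lexx.
(* Here [B * r / eps > 1], so the trivial bound [D] is below the second term of the maximum. *)
have [s sstat] := C_stationary_neq0 X theta V kappa Xcompact theta_lip hSR1 hSR2
  (ex_intro _ x Xx).
apply: le_trans (dist_le x s _ sstat) _; rewrite lee_fin.
have D0 : 0 <= D.
  exact: le_trans (enorm_ge0 _) (enorm_le_diameter X x x Xcompact Xx Xx).
apply: (@le_trans _ _ D); first exact: enorm_le_diameter X x s Xcompact Xx (sstat.1).
apply: (@le_trans _ _ (2 * D / eps * B * r)).
  have -> : 2 * D / eps * B * r = D * (2 * (B * r / eps)) by ring.
  rewrite ler_peMr//; have : 1 <= B * r / eps by rewrite ler_pdivlMr// mul1r ltW.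
  by lra.
by rewrite ler_wpM2r// /etahat le_max lexx orbT.
Qed.
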